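(* Let $\boldsymbol c\in\mathbb R^n$, $\varsigma>0$, $y\in\mathbb R$, $P\in\mathbb R^{n\times n}$ symmetric positive semi-definite and $\boldsymbol f\in\mathbb R^n\setminus\{\boldsymbol 0\}$. Put $\underline\rho:=-\boldsymbol c^T\boldsymbol f+\sqrt{\varsigma\boldsymbol f^TP\boldsymbol f}$ and $\bar\rho:=\boldsymbol c^T\boldsymbol f+\sqrt{\varsigma\boldsymbol f^TP\boldsymbol f}$, and assume that $$-\underline\rho<y+1<\bar\rho\quad\text{or}\quad-\underline\rho<y-1<\bar\rho .$$ Define $$\bar y:=\min(y+1,\bar\rho),\quad \underline y:=\max(y-1,-\underline\rho),\quad \gamma:=\tfrac12(\bar y-\underline y),\quad \delta:=\tfrac12(\bar y+\underline y)-\boldsymbol f^T\boldsymbol c,\quad \alpha:=(\boldsymbol f^TP\boldsymbol f)^{-1},$$ $$\breve{\boldsymbol f}:=\tfrac1\gamma\boldsymbol f,\quad \breve y:=\tfrac1\gamma(\boldsymbol f^T\boldsymbol c+\delta),$$ and, for $\beta\in[0,1)$, $$\breve P(\beta):=P-\alpha\beta P\boldsymbol f\boldsymbol f^TP,\quad \breve{\boldsymbol c}(\beta):=\boldsymbol c+\alpha\beta\delta P\boldsymbol f,\quad \breve\varsigma(\beta):=\varsigma+\alpha\beta\big(\gamma^2(1-\beta)^{-1}-\delta^2\big),$$ $$\mathscr V_\beta(\boldsymbol x):=\big(\boldsymbol x-\breve{\boldsymbol c}(\beta)\big)^T\breve P(\beta)^\dagger\big(\boldsymbol x-\breve{\boldsymbol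 c}(\beta)\big).$$ Then, for every $\beta\in(0,1)$, $$\breve\varsigma(\beta)=\max_{\boldsymbol x\in\mathcal D(\breve{\boldsymbol f},\breve y)\cap\mathcal E(\boldsymbol c,\varsigma P)}\mathscr V_\beta(\boldsymbol x),$$ and the minimizer of $\breve\varsigma$ is $$\beta^*:=\arg\min_{\beta\in[0,1)}\breve\varsigma(\beta)=\begin{cases}1-\gamma|\delta|^{-1}&\text{if }|\delta|>\gamma,\\ 0&\text{otherwise.}\end{cases}$$
   Context: For $\boldsymbol c\in\mathbb R^n$ and $P\in\mathbb R^{n\times n}$ symmetric positive semi-definite, $\mathcal E(\boldsymbol c,P):=\{\boldsymbol c+P^{1/2}\boldsymbol z:\ \|\boldsymbol z\|_2\le 1\}$ (possibly degenerate ellipsoid). For $\boldsymbol d\in\mathbb R^n$, $a\in\mathbb R$, $\mathcal D(\boldsymbol d,a):=\{\boldsymbol x\in\mathbb R^n:|\boldsymbol x^T\boldsymbol d-a|\le 1\}$ is a strip. $M^\dagger$ denotes the Moore–Penrose inverse of $M$.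
   Formalization: The maximum claim fails when P has rank 1 and both y+1 < ρ̄ and y−1 > −ρ̲ (e.g. n=1, c=0, P=f=1, ς=100, y=0); there only the upper bound V_β ≤ ς̆(β) is stated. Equality with the maximum is claimed if rank P ≥ 2, or y+1 ≥ ρ̄, or y−1 ≤ −ρ̲. *)

(* Defs.v *)
From HB Require Import structures.
From mathcomp Require Import all_boot all_order all_algebra.
From mathcomp Require Import boolp classical_sets set_interval reals.

Set Implicit Arguments.
Unset Strict Implicit.
Unset Printing Implicit Defensive.

Import Order.TTheory GRing.Theory Num.Theory.
Local Open Scope classical_set_scope.
Local Open Scope ring_scope.

Section Matrices.
Context {R : realType} {n : nat}.
Implicit Types (c d u v z x : 'cV[R]_n) (P M S X : 'M[R]_n).

Definition dotv u v : R := (u^T *m v) 0 0.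

(* The norm `|z| of the library on matrices is the sup norm. *)
Definition norm2 z : R := Num.sqrt (dotv z z).

Definition qform P x : R := (x^T *m P *m x) 0 0.

Definition psdmx P : Prop := P^T = P /\ forall x, 0 <= qform P x.

(* The principal square root: the unique positive semi-definite S with
   S *m S = P; the default 0 is reached only if P is not psdmx. *)
Definition sqrtmx P : 'M[R]_n := xget 0 [set S | psdmx S /\ S *m S = P].

(* The Moore-Penrose inverse: the unique solution of the four Penrose
   equations, which exists for every M. It is not pinvmx of mxalgebra, which
   satisfies only some of these equations. *)
Definition is_mpinv M X : Prop :=
  [/\ M *m X *m M = M, X *m M *m X = X,
      (M *m X)^T = M *m X & (X *m M)^T = X *m M].
Definition mpinv M : 'M[R]_n := xget 0 [set X | is_mpinv M X].

Definition ellipsoid c P : set 'cV[R]_n :=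
  [set c + sqrtmx P *m z | z in [set z | norm2 z <= 1]].

Definition strip d (a : R) : set 'cV[R]_n := [set x | `|dotv x d - a| <= 1].

End Matrices.

Section Extrema.
Context {R : realType}.

Definition is_max (A : set R) (m : R) : Prop := A m /\ ubound A m.

Definition argmin (A : set R) (g : R -> R) : set R :=
  [set b | A b /\ forall b', A b' -> g b <= g b'].

End Extrema.

(* Main.v *)
(* Every point of E(c, s P) is c + P w with w^T P w <= s. With r = f^T P w, the
   vector w' = w + alpha beta (r - delta) / (1 - beta) f satisfies
   P_breve w' = c + P w - c_breve, so completing the square gives
     V_beta(c + P w) =
       w^T P w + alpha beta ((r - delta)^2 / (1 - beta) - delta^2),
   while the strip is |r - delta| <= gamma. The bound is therefore attained as
   soon as w^T P w = s and r = delta +- gamma hold together: on the line spanned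
   by f when the strip reaches the boundary of the support slab, and after
   adding a P-orthogonal direction when P has rank at least 2.
   The square root and the Moore-Penrose inverse of a symmetric matrix are
   polynomials in it, obtained by interpolation because its minimal polynomial
   splits over R with simple roots. *)

Require Import Defs.
From HB Require Import structures.
From mathcomp Require Import all_boot all_order all_algebra.
From mathcomp Require Import boolp classical_sets set_interval reals.
From mathcomp Require Import complex ring lra.

Set Implicit Arguments.
Unset Strict Implicit.
Unset Printing Implicit Defensive.

Import Order.TTheory GRing.Theory Num.Theory.
Local Open Scope classical_set_scope.
Local Open Scope ring_scope.

(** * Polynomial calculus of real symmetric matrices *)

(** Over [R[i]] the matrix is unitarily diagonalizable with real diagonal, so its minimal polynomial
    is the product over the distinct diagonal entries; the factorization descends along the
    injective embedding of [R]. *)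
Lemma symmx_mxminpoly (R : realType) (n : nat) (M : 'M[R]_n.+1) : M^T = M ->
  exists2 s : seq R, uniq s & mxminpoly M = \prod_(x <- s) ('X - x%:P).
Proof.
move=> symM; pose rc : {rmorphism R -> R[i]} := real_complex R.
pose A := map_mx rc M.
have Areal : A \is a mxOver Num.real.
  by apply/mxOverP => i j; rewrite mxE; apply/complex_realP; exists (M i j).
have Asym : A \is symmetricmx.
  apply/is_hermitianmxP; rewrite expr0 scale1r map_mx_id // /A.
  by rewrite map_trmx symM.
have Aherm := realsym_hermsym Asym Areal.
have /orthomx_spectralP AE := symmetric_normalmx Asym Areal.
have /mxOverP dreal := hermitian_spectral_diag_real Aherm.
set U := spectralmx A in AE; set d := spectral_diag A in AE dreal.
have Uu : U \in unitmx by apply: spectral_unit.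
pose u := undup [seq d 0 i | i <- enum 'I_n.+1].
have minA : mxminpoly A = \prod_(r <- u) ('X - r%:P).
  rewrite [in LHS]AE -{2}[U]invmxK -conjumx ?unitmx_inv //.
  by rewrite mxminpoly_uconj ?unitmx_inv // mxminpoly_diag.
pose s := [seq complex.Re x | x <- u].
have us : [seq rc x | x <- s] = u.
  rewrite -map_comp -[RHS]map_id; apply/eq_in_map => x.
  rewrite mem_undup => /mapP[i _ ->] /=.
  by apply: RRe_real; apply: dreal.
exists s.
  have : uniq u by apply: undup_uniq.
  by rewrite -us map_inj_uniq //; exact: complexI.
apply: (map_poly_inj rc).
rewrite -mxminpoly_map minA -[in LHS]us big_map rmorph_prod.
by apply: eq_bigr => x _; rewrite rmorphB /= map_polyX map_polyC.
Qed.

Lemma poly_interpolation (F : fieldType) (s : seq F) (g : F -> F) : uniq s ->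
  exists p : {poly F}, {in s, forall x, p.[x] = g x}.
Proof.
elim: s => [|a s IH] /=; first by exists 0.
case/andP=> as_ us; have [p ps] := IH us.
pose q : {poly F} := \prod_(x <- s) ('X - x%:P).
have qa : q.[a] != 0 by move: as_; rewrite -root_prod_XsubC rootE.
exists (p + ((g a - p.[a]) / q.[a])%:P * q) => x; rewrite inE.
rewrite hornerD hornerM hornerC; case/predU1P => [->|xs].
  by rewrite divfK // addrC subrK.
have /eqP -> : q.[x] == 0 by rewrite -rootE root_prod_XsubC.
by rewrite mulr0 addr0 ps.
Qed.

Lemma trmx_horner_mx (R : comNzRingType) (n : nat) (M : 'M[R]_n.+1) p :
  M^T = M -> (horner_mx M p)^T = horner_mx M p.
Proof.
move=> symM; elim/poly_ind: p => [|p a IH]; first by rewrite rmorph0 trmx0.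
rewrite rmorphD rmorphM /= horner_mx_X horner_mx_C linearD /= tr_scalar_mx.
by rewrite trmx_mul IH symM [M *m _]comm_mx_horner.
Qed.

(** As the roots of the minimal polynomial are simple, it divides any difference [p - q] that
    vanishes on them. *)
Lemma symmx_calculus (R : realType) (n : nat) (M : 'M[R]_n.+1) : M^T = M ->
  exists s : seq R, [/\ uniq s, {in s, forall x, eigenvalue M x} &
    forall p q, {in s, forall x, p.[x] = q.[x]} ->
      horner_mx M p = horner_mx M q].
Proof.
move=> /symmx_mxminpoly [s us minM]; exists s; split=> // [x xs|p q pq].
  by rewrite eigenvalue_root_min minM root_prod_XsubC.
apply/eqP; rewrite -subr_eq0 -rmorphB /= -dvd_mxminpoly minM.
apply: uniq_roots_dvdp; last by rewrite uniq_rootsE.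
by apply/allP => x xs; rewrite rootE hornerD hornerN pq // subrr.
Qed.

(** * Moore-Penrose inverse and principal square root *)

Lemma is_mpinv_symmx (R : realType) (n : nat) (M : 'M[R]_n) : M^T = M ->
  is_mpinv M (mpinv M).
Proof.
move=> symM; apply: xgetPex.
case: n M symM => [|n] M symM.
  by exists 0; split; apply/matrixP => -[].
have [s [us _ sM]] := symmx_calculus symM.
(* The convention [0^-1 = 0] is what makes the scalar Penrose identities hold at the eigenvalue 0
   too. *)
have [p ps] := @poly_interpolation _ s (fun x => x^-1) us.
have tr_horner q := @trmx_horner_mx _ _ M q symM.
have MX : M *m horner_mx M p = horner_mx M ('X * p).
  by rewrite rmorphM /= horner_mx_X.
have XM : horner_mx M p *m M = horner_mx M (p * 'X).
  by rewrite rmorphM /= horner_mx_X.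
exists (horner_mx M p); split; rewrite ?MX ?XM ?tr_horner //.
- transitivity (horner_mx M ('X * p * 'X)).
    by rewrite [RHS]rmorphM /= horner_mx_X.
  rewrite -[RHS]horner_mx_X; apply: sM => x xs; rewrite !hornerM hornerX ps //.
  by have [->|x0] := eqVneq x 0; rewrite ?mul0r // divff ?mul1r.
- transitivity (horner_mx M (p * 'X * p)); first by rewrite [RHS]rmorphM.
  apply: sM => x xs; rewrite !hornerM hornerX ps //.
  by have [->|x0] := eqVneq x 0; rewrite ?invr0 ?mul0r // mulVf ?mul1r.
Qed.

Lemma psdmx_eigenvalue_ge0 (R : realType) (n : nat) (P : 'M[R]_n) a :
  psdmx P -> eigenvalue P a -> 0 <= a.
Proof.
move=> [_ Ppos] /eigenvalueP[v vP v0]; have := Ppos v^T.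
rewrite /qform trmxK vP -scalemxAl mxE.
have vv : 0 < (v *m v^T) 0 0.
  rewrite mxE; have /rV0Pn[i vi] := v0.
  rewrite (bigD1 i) //= ltr_pwDl //.
    by rewrite mxE -expr2 exprn_even_gt0.
  by apply: sumr_ge0 => j _; rewrite mxE -expr2 sqr_ge0.
by rewrite pmulr_lge0.
Qed.

Lemma sqrtmxP (R : realType) (n : nat) (P : 'M[R]_n) : psdmx P ->
  psdmx (sqrtmx P) /\ sqrtmx P *m sqrtmx P = P.
Proof.
move=> psdP; apply: (@xgetPex _ 0 [set S | psdmx S /\ S *m S = P]).
case: n P psdP => [|n] P psdP.
  exists 0; split; last by apply/matrixP => -[].
  by split=> [|x]; rewrite ?trmx0 // /qform mulmx0 mul0mx mxE.
have [symP _] := psdP; have [s [us eigs sP]] := symmx_calculus symP.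
(* Fourth roots are interpolated so that the square root is [Q *m Q] with [Q] symmetric, a Gram
   matrix, hence positive semi-definite. *)
have [p ps] := @poly_interpolation _ s (fun x => Num.sqrt (Num.sqrt x)) us.
pose Q := horner_mx P p.
have symQ : Q^T = Q by apply: trmx_horner_mx.
exists (Q *m Q); split; first split=> [|x].
- by rewrite trmx_mul symQ.
- have -> : qform (Q *m Q) x = ((Q *m x)^T *m (Q *m x)) 0 0.
    by rewrite /qform trmx_mul symQ !mulmxA.
  by rewrite mxE; apply: sumr_ge0 => j _; rewrite mxE -expr2 sqr_ge0.
transitivity (horner_mx P (p * p * (p * p))); first by rewrite !rmorphM.
rewrite -[RHS]horner_mx_X; apply: sP => x xs.
rewrite !hornerM ps // hornerX -!expr2 !sqr_sqrtr ?sqrtr_ge0 //.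
exact: psdmx_eigenvalue_ge0 (eigs x xs).
Qed.

(** * Quadratic forms, ellipsoids and the rank-one update of [P] *)

Section EuclideanForms.
Context {R : realType} {n : nat}.
Implicit Types (u v w x z f : 'cV[R]_n) (P M : 'M[R]_n).

Lemma dotvC u v : dotv u v = dotv v u.
Proof. by rewrite /dotv -[u^T *m v]trmxK mxE trmx_mul trmxK. Qed.

Lemma dotvDr u v w : dotv u (v + w) = dotv u v + dotv u w.
Proof. by rewrite /dotv mulmxDr mxE. Qed.

Lemma dotvZr u a v : dotv u (a *: v) = a * dotv u v.
Proof. by rewrite /dotv -scalemxAr mxE. Qed.

Lemma dotvDl u v w : dotv (u + v) w = dotv u w + dotv v w.
Proof. by rewrite dotvC dotvDr !(dotvC w). Qed.

Lemma dotvZl u a v : dotv (a *: u) v = a * dotv u v.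
Proof. by rewrite dotvC dotvZr dotvC. Qed.

Lemma dotv_ge0 u : 0 <= dotv u u.
Proof.
by rewrite /dotv mxE; apply: sumr_ge0 => j _; rewrite mxE -expr2 sqr_ge0.
Qed.

Lemma dotv_eq0 u : dotv u u = 0 -> u = 0.
Proof.
move=> /eqP; rewrite /dotv mxE psumr_eq0 => [/allP u0|j _]; last first.
  by rewrite mxE -expr2 sqr_ge0.
apply/matrixP => i j; rewrite ord1 !mxE.
have /implyP/(_ isT) := u0 i (mem_index_enum i).
by rewrite mxE -expr2 sqrf_eq0 => /eqP.
Qed.

Lemma dotv_mulmxl P u v : P^T = P -> dotv (P *m u) v = dotv u (P *m v).
Proof. by move=> symP; rewrite /dotv trmx_mul symP mulmxA. Qed.

Lemma qformE P x : qform P x = dotv x (P *m x).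
Proof. by rewrite /qform /dotv mulmxA. Qed.

Lemma norm2_le1 z : (norm2 z <= 1) = (dotv z z <= 1).
Proof. by rewrite /norm2 -[X in _ <= X]sqrtr1 ler_sqrt ?ltr01. Qed.

Lemma qform_eq0 P x : psdmx P -> qform P x = 0 -> P *m x = 0.
Proof.
move=> psdP; have [[symS _] SS] := sqrtmxP psdP.
rewrite -{1}SS qformE -mulmxA -dotv_mulmxl // => /dotv_eq0 Sx0.
by rewrite -SS -mulmxA Sx0 mulmx0.
Qed.

Lemma psdmxZ a P : 0 <= a -> psdmx P -> psdmx (a *: P).
Proof.
move=> a0 [symP Ppos]; split=> [|x]; first by rewrite linearZ /= symP.
by rewrite qformE -scalemxAl dotvZr -qformE mulr_ge0.
Qed.

Lemma ellipsoid_psdE c s P x : 0 < s -> psdmx P ->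
  ellipsoid c (s *: P) x <-> exists2 w, x = c + P *m w & qform P w <= s.
Proof.
move=> s0 psdP; have [[symS _]] := sqrtmxP (psdmxZ (ltW s0) psdP).
rewrite /ellipsoid /=; set S := sqrtmx _ in symS * => SS.
have Sw w : dotv (S *m w) (S *m w) = s * qform P w.
  by rewrite dotv_mulmxl // mulmxA SS -scalemxAl dotvZr -qformE.
split=> [[z /=]|[w -> Pw]].
  rewrite norm2_le1 => z1 <-.
  have [X [SXS _ _ XS]] : exists X, is_mpinv S X.
    by exists (mpinv S); apply: is_mpinv_symmx.
  (* Symmetry of [X *m S] turns [S = S *m X *m S] into [S = S *m S *m X^T]; so the range of [S] lies
     in that of [P]. *)
  have SE : S = s *: P *m X^T.
    by rewrite -SS -{1}SXS -mulmxA -XS trmx_mul symS mulmxA.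
  set w := s *: X^T *m z.
  have zw : S *m z = P *m w.
    by rewrite {1}SE /w -!scalemxAl -scalemxAr !mulmxA.
  exists w; first by rewrite zw.
  (* Expanding |S w - s z|^2 >= 0 replaces the Cauchy-Schwarz inequality. *)
  have := dotv_ge0 (S *m w + (- s) *: z).
  rewrite !(dotvDl, dotvDr, dotvZl, dotvZr) Sw (dotvC z) dotv_mulmxl // zw.
  rewrite -qformE => H.
  have : s * qform P w <= s * (s * dotv z z) by move: H; lra.
  rewrite ler_pM2l // => /le_trans; apply.
  by rewrite ger_pMr.
exists (s^-1 *: (S *m w)) => /=.
  rewrite norm2_le1 dotvZl dotvZr Sw mulKf ?gt_eqF //.
  by rewrite mulrC ler_pdivrMr // mul1r.
by rewrite -scalemxAr mulmxA SS -scalemxAl scalerA mulVf ?gt_eqF // scale1r.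
Qed.

Lemma qform_mpinv M w : M^T = M -> qform (mpinv M) (M *m w) = qform M w.
Proof.
move=> symM; have [MXM _ _ _] := is_mpinv_symmx symM.
by rewrite !qformE dotv_mulmxl // !mulmxA MXM.
Qed.

Lemma updated_qform P f w b d (q := qform P f) (a := q^-1) :
  P^T = P -> q != 0 -> b != 1 ->
  qform (mpinv (P - (a * b) *: (P *m f *m f^T *m P)))
        (P *m w - (a * b * d) *: (P *m f)) =
  qform P w + a * b * ((dotv f (P *m w) - d) ^+ 2 * (1 - b)^-1 - d ^+ 2).
Proof.
move=> symP q0 b1; set Pb := P - _; set r := dotv f (P *m w).
have b1' : 1 - b != 0 by rewrite subr_eq0 eq_sym.
have Pb_mul x : Pb *m x = P *m x - (a * b * dotv f (P *m x)) *: (P *m f).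
  rewrite mulmxBl -scalemxAl -scalerA -!mulmxA; congr (_ - _ *: _).
  by rewrite [f^T *m _]mx11_scalar mul_mx_scalar -scalemxAr.
have symPb : Pb^T = Pb.
  by rewrite linearB linearZ /= !trmx_mul trmxK symP !mulmxA.
(* Since [Pb *m f = (1 - b) *: (P *m f)], the required equality amounts to
   [t * (1 - b) - a * b * r = - (a * b * d)], whose solution is this [t]. *)
pose t := a * b * (r - d) / (1 - b).
have -> : P *m w - (a * b * d) *: (P *m f) = Pb *m (w + t *: f).
  rewrite Pb_mul mulmxDr -scalemxAr dotvDr dotvZr -/r -qformE -/q.
  rewrite -addrA -scalerBl -scaleNr; congr (_ + _ *: _).
  by rewrite /t /a; field; rewrite b1' q0.
rewrite qform_mpinv // qformE Pb_mul mulmxDr -scalemxAr.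
rewrite dotvDr -scaleNr !(dotvDl, dotvZl, dotvDr, dotvZr).
rewrite (dotvC w (P *m f)) dotv_mulmxl // -!qformE -/q -/r.
by rewrite /t /a; field; rewrite b1' q0.
Qed.

(** By contraposition: if [P] kills every vector P-orthogonal to [f], it equals the rank-one matrix
    [q^-1 *: (P *m f *m f^T *m P)]. *)
Lemma psdmx_rank_gt1 P f : P^T = P -> qform P f != 0 -> (1 < \rank P)%N ->
  exists2 h, dotv f (P *m h) = 0 & P *m h != 0.
Proof.
move=> symP q0; set q := qform P f in q0.
apply: contraTP => noh; rewrite -leqNgt.
have -> : P = P *m f *m (q^-1 *: (f^T *m P)).
  apply/matrixP => i j; pose g : 'cV[R]_n := delta_mx j 0.
  (* A basis vector minus its P-orthogonal projection onto [f]. *)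
  pose h := g - (q^-1 * dotv f (P *m g)) *: f.
  have Pg : P *m g = P *m f *m (q^-1 *: (f^T *m P)) *m g.
    apply/eqP; rewrite -subr_eq0; apply/negPn/negP => Pg; apply: noh; exists h.
      rewrite /h mulmxDr -scaleNr -scalemxAr dotvDr dotvZr -qformE -/q.
      by field.
    move: Pg; congr (_ != 0); rewrite /h mulmxBr; congr (_ - _).
    rewrite -!scalemxAr -!scalemxAl -scalerA -!mulmxA; congr (_ *: _).
    by rewrite [f^T *m _]mx11_scalar mul_mx_scalar -scalemxAr.
  have := congr1 (fun A : 'cV[R]_n => A i 0) Pg.
  by rewrite -!colE !mxE.
exact: leq_trans (mxrankM_maxl _ _) (rank_leq_col _).
Qed.

Lemma qform_slice P f s r : psdmx P -> 0 < qform P f -> (1 < \rank P)%N ->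
  r ^+ 2 <= s * qform P f ->
  exists2 w, dotv f (P *m w) = r & qform P w = s.
Proof.
move=> psdP; have [symP Ppos] := psdP; set q := qform P f => q0 rP rs.
have q0' : q != 0 by rewrite gt_eqF.
have [h fh Ph0] := psdmx_rank_gt1 symP q0' rP.
have hh : 0 < qform P h.
  rewrite lt_neqAle Ppos andbT; apply: contra Ph0 => /eqP/esym.
  by move=> /(qform_eq0 psdP) ->.
have hf : dotv h (P *m f) = 0 by rewrite -dotv_mulmxl // dotvC.
(* The component along [f] that gives the value [r] contributes [r ^+ 2 / q] to the form; [t] makes
   the P-orthogonal [h] supply the rest, nonnegative by the bound on [r]. *)
pose t := Num.sqrt ((s - r ^+ 2 / q) / qform P h).
have t2 : t ^+ 2 = (s - r ^+ 2 / q) / qform P h.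
  by rewrite sqr_sqrtr // divr_ge0 ?(ltW hh) // subr_ge0 ler_pdivrMr.
exists ((r / q) *: f + t *: h).
  rewrite mulmxDr -!scalemxAr dotvDr !dotvZr fh -qformE -/q.
  by rewrite mulr0 addr0 divfK.
rewrite qformE mulmxDr -!scalemxAr !(dotvDl, dotvZl, dotvDr, dotvZr).
rewrite hf fh -!qformE -/q !mulr0 add0r addr0 [t * _]mulrA -expr2.
by rewrite t2; field; rewrite q0' gt_eqF.
Qed.

End EuclideanForms.

(** * Minimization over [beta] *)

Lemma argmin_varsigma (R : realType) (s a g d : R) : 0 < a -> 0 < g ->
  argmin `[0, 1[ (fun b => s + a * b * (g ^+ 2 * (1 - b)^-1 - d ^+ 2)) =
  [set if `|d| > g then 1 - g * `|d|^-1 else 0].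
Proof.
move=> a0 g0; set F := fun b : R => _.
set b0 := (X in [set X]).
have d2 : d ^+ 2 = `|d| ^+ 2 by rewrite real_normK ?num_real.
(* Strict inequality away from [b0] gives uniqueness, hence a singleton. *)
have [b0I b0min] : `[0, 1[%classic b0 /\
    forall b, `[0, 1[%classic b -> b != b0 -> F b0 < F b.
  rewrite /b0 /= in_itv /=; case: ifPn => [gd|]; last rewrite -leNgt => dg.
  - have d0 : 0 < `|d| by exact: lt_trans gd.
    have dn : `|d| != 0 by rewrite gt_eqF.
    split=> [|b]; first rewrite subr_ge0 ler_pdivrMr // mul1r ltW //=.
      by rewrite gtrBl divr_gt0.
    rewrite in_itv /= => /andP[b0' b1] bne.
    have t0 : 0 < 1 - b by rewrite subr_gt0.
    have tn : 1 - b != 0 by rewrite gt_eqF.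
    rewrite -subr_gt0 /F d2.
    (* The excess over the value at [b0] is a perfect square divided by [1 - b], vanishing only
       where [1 - b = g / |d|]. *)
    have -> : s + a * b * (g ^+ 2 * (1 - b)^-1 - `|d| ^+ 2) -
        (s + a * (1 - g / `|d|) * (g ^+ 2 * (1 - (1 - g / `|d|))^-1 - `|d| ^+ 2))
      = a * ((g - `|d| * (1 - b)) ^+ 2 / (1 - b)).
      have -> : 1 - (1 - g / `|d|) = g / `|d| by ring.
      by field; rewrite dn tn gt_eqF.
    rewrite mulr_gt0 // divr_gt0 // exprn_even_gt0 //=.
    apply: contra bne => /eqP e; apply/eqP.
    have -> : g = `|d| * (1 - b) by lra.
    by field.
  - split=> [|b]; first by rewrite lexx ltr01.
    rewrite in_itv /= => /andP[b0' b1] bne.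
    have bp : 0 < b by rewrite lt_neqAle eq_sym bne.
    have t0 : 0 < 1 - b by rewrite subr_gt0.
    rewrite /F mulr0 mul0r addr0 ltrDl !mulr_gt0 // subr_gt0.
    rewrite ltr_pdivlMr // d2.
    have : `|d| ^+ 2 <= g ^+ 2 by rewrite ler_sqr ?nnegrE ?(ltW g0).
    have : 0 < g ^+ 2 by rewrite exprn_gt0.
    have : 0 <= `|d| ^+ 2 by rewrite sqr_ge0.
    by nra.
apply/seteqP; split=> b /=.
  move=> [bI bmin]; apply/eqP/negPn/negP => bne.
  by have := lt_le_trans (b0min _ bI bne) (bmin _ b0I); rewrite ltxx.
move=> ->; split=> // b' b'I; have [->//|bne] := eqVneq b' b0.
exact/ltW/b0min.
Qed.

(** * The bound, its attainment and the minimizer *)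

Unset Implicit Arguments.

(* The bound V_beta <= varsigma_breve(beta) is stated in all cases; that it is
   attained is stated except when P has rank 1 and the strip |y - f^T x| <= 1
   lies strictly inside the support slab of the ellipsoid: then it is never
   attained (n = 1, c = 0, P = f = 1, varsigma = 100, y = 0 is an example). *)
Theorem theorem4p5 (R : realType) (n : nat)
    (c : 'cV[R]_n) (varsigma y : R) (P : 'M[R]_n) (f : 'cV[R]_n) :
  0 < varsigma -> psdmx P -> f != 0 ->
  let rho_lo := - dotv c f + Num.sqrt (varsigma * qform P f) in
  let rho_hi := dotv c f + Num.sqrt (varsigma * qform P f) in
  (- rho_lo < y + 1 < rho_hi) \/ (- rho_lo < y - 1 < rho_hi) ->
  let y_hi := Num.min (y + 1) rho_hi in
  let y_lo := Num.max (y - 1) (- rho_lo) in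
  let gamma := 2^-1 * (y_hi - y_lo) in
  let delta := 2^-1 * (y_hi + y_lo) - dotv f c in
  let alpha := (qform P f)^-1 in
  let f_breve := gamma^-1 *: f in
  let y_breve := gamma^-1 * (dotv f c + delta) in
  let P_breve := fun beta : R =>
    P - (alpha * beta) *: (P *m f *m f^T *m P) in
  let c_breve := fun beta : R => c + (alpha * beta * delta) *: (P *m f) in
  let varsigma_breve := fun beta : R =>
    varsigma + alpha * beta * (gamma ^+ 2 * (1 - beta)^-1 - delta ^+ 2) in
  let V := fun (beta : R) (x : 'cV[R]_n) =>
    qform (mpinv (P_breve beta)) (x - c_breve beta) in
  let K := strip f_breve y_breve `&` ellipsoid c (varsigma *: P) in
  (forall beta : R, 0 < beta < 1 ->
     ubound (V beta @` K) (varsigma_breve beta) /\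
     ((1 < \rank P)%N \/ rho_hi <= y + 1 \/ y - 1 <= - rho_lo ->
        is_max (V beta @` K) (varsigma_breve beta)))
  /\ argmin `[0, 1[ varsigma_breve =
       [set if `|delta| > gamma then 1 - gamma * `|delta|^-1 else 0].
Proof.
move=> s0 psdP f0 rho_lo rho_hi H y_hi y_lo gamma delta alpha f_breve y_breve.
move=> P_breve c_breve varsigma_breve V K.
have [symP Ppos] := psdP.
pose q := qform P f; pose cf := dotv f c; pose rt := Num.sqrt (varsigma * q).
have rho_loE : - rho_lo = cf - rt by rewrite /rho_lo opprD opprK dotvC.
have rho_hiE : rho_hi = cf + rt by rewrite /rho_hi dotvC.
(* One of [y + 1], [y - 1] lies strictly between [cf - rt] and [cf + rt], so [rt] is positive; this
   in turn forces [q > 0]. *)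
have rt0 : 0 < rt by case: H => /andP[]; rewrite rho_loE rho_hiE; lra.
have rt2 : rt ^+ 2 = varsigma * q.
  by rewrite sqr_sqrtr // mulr_ge0 ?(ltW s0) //; exact: Ppos.
have q0 : 0 < q.
  have : 0 < varsigma * q by rewrite -rt2 exprn_gt0.
  by rewrite pmulr_rgt0.
have qn : q != 0 by rewrite gt_eqF.
have a0 : 0 < alpha by rewrite invr_gt0.
have y_lt : y_lo < y_hi.
  rewrite /y_lo /y_hi lt_min !gt_max rho_loE rho_hiE.
  by case: H; rewrite rho_loE rho_hiE => /andP[? ?]; apply/and3P; split;
    try (apply/andP; split); lra.
have g0 : 0 < gamma by rewrite /gamma; lra.
have y_hi_le : y_hi - cf <= rt.
  by rewrite lerBlDl -rho_hiE /y_hi ge_min lexx orbT.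
have y_lo_ge : - rt <= y_lo - cf.
  by rewrite lerBrDl -rho_loE /y_lo le_max lexx orbT.
(* Measured from the center value [cf], the clipped strip is the interval from [delta - gamma] to
   [delta + gamma], inside [[- rt, rt]]. *)
have dgE : delta + gamma = y_hi - cf by rewrite /delta /gamma -/cf; field.
have dgE' : delta - gamma = y_lo - cf by rewrite /delta /gamma -/cf; field.
have stripE w : strip f_breve y_breve (c + P *m w) <->
    (dotv f (P *m w) - delta) ^+ 2 <= gamma ^+ 2.
  rewrite /strip /= /f_breve /y_breve dotvZr dotvC dotvDr -mulrBr normrM.
  rewrite gtr0_norm ?invr_gt0 // mulrC ler_pdivrMr // mul1r.
  have -> : dotv f c + dotv f (P *m w) - (dotv f c + delta) =
            dotv f (P *m w) - delta by ring.
  by rewrite -(real_normK (num_real (_ - _))) ler_sqr ?nnegrE ?(ltW g0).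
have VE beta w : beta < 1 -> V beta (c + P *m w) = qform P w +
    alpha * beta * ((dotv f (P *m w) - delta) ^+ 2 * (1 - beta)^-1 - delta ^+ 2).
  move=> b1; rewrite -updated_qform ?(lt_eqF b1) // /V /P_breve /c_breve.
  by congr (qform _ _); rewrite opprD addrACA subrr add0r.
split; last exact: argmin_varsigma.
move=> beta /andP[b0 b1].
have ab0 : 0 < alpha * beta by rewrite mulr_gt0.
have ub : ubound (V beta @` K) (varsigma_breve beta).
  move=> _ [x [xS /(ellipsoid_psdE _ _ s0 psdP)[w xE qw]] <-].
  move: xS; rewrite xE => /stripE rw.
  rewrite VE // lerD // ler_pM2l // lerB // ler_pM2r // invr_gt0.
  by rewrite subr_gt0.
split=> // attained; split=> //.
suff [w [r [wr rE qw]]] : exists w r, [/\ dotv f (P *m w) = r,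
    (r - delta) ^+ 2 = gamma ^+ 2 & qform P w = varsigma].
  exists (c + P *m w); last by rewrite VE // wr rE qw.
  split; first by apply/stripE; rewrite wr rE.
  by apply/(ellipsoid_psdE _ _ s0 psdP); exists w; rewrite ?qw.
(* With [e] equal to 1 or -1, these are the two points where the ellipsoid touches the faces of its
   support slab. *)
have extreme e : e ^+ 2 = 1 -> let w := (e * rt / q) *: f in
    dotv f (P *m w) = e * rt /\ qform P w = varsigma.
  move=> e2 /=; rewrite qformE -!scalemxAr !(dotvZl, dotvZr) -qformE -/q.
  split; first by field.
  have -> : e * rt / q * (e * rt / q * q) = e ^+ 2 * rt ^+ 2 / q by field.
  by rewrite e2 rt2; field.
case: attained => [rP|[hi|lo]].
- have [|w wr qw] := @qform_slice _ _ P f varsigma (delta + gamma) psdP q0 rP.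
    have : - rt <= delta + gamma <= rt by apply/andP; split; lra.
    rewrite -ler_norml -rt2 -(real_normK (num_real (_ + _))) => ?.
    by rewrite ler_sqr ?nnegrE ?(ltW rt0).
  by exists w, (delta + gamma); split=> //; ring.
(* Here clipping puts the upper end of the strip on the slab face, so [delta + gamma = rt]. *)
- have [wr qw] := extreme 1 (expr1n _ _).
  eexists _, _; split; [exact: wr| |exact: qw].
  have : y_hi = rho_hi by rewrite /y_hi; apply: min_r.
  rewrite rho_hiE => yh; have -> : 1 * rt = delta + gamma by lra.
  by ring.
- have [|wr qw] := extreme (- 1); first by ring.
  eexists _, _; split; [exact: wr| |exact: qw].
  have : y_lo = - rho_lo by rewrite /y_lo; apply: max_r.
  rewrite rho_loE => yl; have -> : - 1 * rt = delta - gamma by lra.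
  by ring.
Qed.
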